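(* Let $X$ be a metric space of finite asymptotic dimension and let $n\ge 0$ be an integer. Then the following conditions are equivalent: (a) $S^n$ is a large scale absolute extensor of $X$; (b) $\operatorname{asdim} X\le n$.
   Context: Asymptotic dimension: for a family $\mathcal U$ of subsets of $X$, $\dim(\mathcal U)\le n$ means each $x\in X$ lies in at most $n+1$ elements of $\mathcal U$. The Lebesgue number of a cover $\mathcal U$ of $X$ is the supremum of all $r\ge 0$ such that every ball $B(x,r)$ is contained in some element of $\mathcal U$. A cover is uniformly bounded if the supremum of the diameters of its elements is finite. $\operatorname{asdim}X\le n$ means: for every $\lambda>0$ there is a uniformly bounded cover of $X$ with Lebesgue number at least $\lambda$ and dimension at most $n$. $X$ has finite asymptotic dimension if $\operatorname{asdim}X\le N$ for some integer $N\ge 0$. A function $f\colon X\to Y$ of metric spaces (not assumed continuous) is slowly oscillating if, for a base point $x_0\in X$ (whose choice is irrelevant), for all $R,\epsilon>0$ there is $N>0$ such that for every $x\in X$ with $d(x_0,x)>N$ the diameter of $f(B(x,R))$ is less than $\epsilon$. A metric space $K$ is a large scale absolute extensor of a metric space $X$ if for every subset $A\subset X$ and every slowly oscillating $f\colon A\to K$ there is a slowly oscillating $g\colon X\to K$ with $g|_A=f$. $S^n$ denotes the boundary $\partial\Delta^{n+1}$ of the standard unit $(n+1)$-simplex with the $\ell_1$-metric (bi-Lipschitz equivalent to the unit sphere of $\mathbb R^{n+1}$). *)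

(* Defs.v *)
From HB Require Import structures.
From mathcomp Require Import all_boot all_order all_algebra.
From mathcomp Require Import all_classical all_reals all_analysis.

Set Implicit Arguments.
Unset Strict Implicit.
Unset Printing Implicit Defensive.

Import Order.TTheory GRing.Theory Num.Theory.

Local Open Scope classical_set_scope.
Local Open Scope ring_scope.
Local Open Scope card_scope.

(* The library makes [A : set X] a pseudometric space through the inclusion
   [set_val : A -> X]; its distance is the restriction of that of [X]. *)
Section subset_metric.
Context {R : realType} {X : metricType R} (A : set X).

Let sdist (a b : A) : R := mdist (set_val a) (set_val b).

Let sdist_ge0 a b : 0 <= sdist a b.
Proof. exact: mdist_ge0. Qed.

Let sdist_positivity a b : sdist a b = 0 -> a = b.
Proof. by move=> /mdist_positivity; exact: val_inj. Qed.

Let ballEsdist (a : A) (r : R) : ball a r = [set b | sdist a b < r].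
Proof.
by rewrite {1}/ball /= /initial_ball ballEmdist.
Qed.

HB.instance Definition _ := PseudoMetric_isMetric.Build R (set_type A)
  sdist_ge0 sdist_positivity ballEsdist.

End subset_metric.

Section asymptotic_dimension.
Context {R : realType} {X : metricType R}.
Implicit Types (A : set X) (U : set (set X)).

(* [maxe 0] only matters for [A = set0], where the supremum is [-oo]. *)
Definition diam A : \bar R :=
  maxe 0%E (ereal_sup [set (mdist p.1 p.2)%:E | p in A `*` A]).

Definition is_cover U : Prop := cover U id = setT.

Definition dim_le U (n : nat) : Prop :=
  forall x : X, [set V | U V /\ V x] #<= `I_n.+1.

Definition lebesgue_number U : \bar R :=
  ereal_sup [set r%:E | r in
    [set r : R | 0 <= r /\ forall x : X, exists2 V, U V & ball x r `<=` V]].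

Definition uniformly_bounded U : Prop := (ereal_sup [set diam V | V in U] < +oo)%E.

End asymptotic_dimension.

Definition asdim_le {R : realType} (X : metricType R) (n : nat) : Prop :=
  forall lambda : R, 0 < lambda ->
    exists U : set (set X),
      [/\ is_cover U, uniformly_bounded U,
          (lambda%:E <= lebesgue_number U)%E & dim_le U n].

Definition finite_asdim {R : realType} (X : metricType R) : Prop :=
  exists N : nat, asdim_le X N.

(* Quantifying over all base points is the same as fixing one, and makes sense
   (vacuously) when [X] is empty. *)
Definition slowly_oscillating {R : realType} {X Y : metricType R}
    (f : X -> Y) : Prop :=
  forall (x0 : X) (r e : R), 0 < r -> 0 < e ->
    exists2 N : R, 0 < N &
      forall x : X, N < mdist x0 x -> (diam (f @` ball x r) < e%:E)%E.

Definition large_scale_absolute_extensor {R : realType} (K X : metricType R)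
    : Prop :=
  forall (A : set X) (f : A -> K), slowly_oscillating f ->
    exists2 g : X -> K, slowly_oscillating g &
      forall a : A, g (set_val a) = f a.

Section sphere.
Context {R : realType} (n : nat).

(* The simplex with [n.+2] vertices, hence of dimension [n.+1], in barycentric
   coordinates. *)
Definition std_simplex (x : 'rV[R]_n.+2) : bool :=
  [forall i, 0 <= x 0 i] && (\sum_i x 0 i == 1).

(* The boundary is the union of the proper faces, i.e., of the [x 0 i = 0]. *)
Definition simplex_boundary (x : 'rV[R]_n.+2) : bool :=
  std_simplex x && [exists i, x 0 i == 0].

(* A new type, so as not to inherit the sup distance of ['rV[R]_n.+2]. *)
Record sphere := Sphere {
  sphere_val :> 'rV[R]_n.+2;
  sphere_valP : simplex_boundary sphere_val }.

HB.instance Definition _ := [isSub for sphere_val].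
HB.instance Definition _ := [Choice of sphere by <:].

Definition l1_dist (x y : sphere) : R :=
  \sum_i `|sphere_val x 0 i - sphere_val y 0 i|.

Let l1_distxx x : l1_dist x x = 0.
Proof. by rewrite /l1_dist big1 // => i _; rewrite subrr normr0. Qed.

Let l1_dist_positivity x y : l1_dist x y = 0 -> x = y.
Proof.
move=> /eqP; rewrite psumr_eq0 => [|i _]; last exact: normr_ge0.
move=> /allP xy; apply/val_inj/rowP => i.
by apply/eqP; rewrite -subr_eq0 -normr_eq0; apply: xy; rewrite mem_index_enum.
Qed.

Let l1_dist_sym x y : l1_dist x y = l1_dist y x.
Proof. by apply: eq_bigr => i _; rewrite distrC. Qed.

Let l1_dist_triangle y x z : l1_dist x z <= l1_dist x y + l1_dist y z.
Proof.
by rewrite /l1_dist -big_split; apply: ler_sum => i _; exact: ler_distD.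
Qed.

HB.instance Definition _ := isMetric.Build R sphere
  l1_distxx l1_dist_positivity l1_dist_sym l1_dist_triangle.

End sphere.

Arguments sphere : clear implicits.

(* Main.v *)
(* Call a finite family [G] of subsets of [X] a coarse cover if, for every [r],
   each ball of radius [r] far from the base point lies in some [G i]. Both
   conditions are compared with a third one, [shrinkable]: every coarse cover
   by [n + 2] sets shrinks to a coarse cover with empty intersection.
   - A coarse cover has a subordinate slowly oscillating partition of unity,
     i.e., a map to the simplex. Where it hits the boundary, it is a map to
     [S^n]; an extension [g] of it gives the shrinking [g i > 0], because all
     members of the cover contain the points outside of the domain.
   - Conversely, [f : A -> S^n] is extended near [A] by its value at a close
     point of [A] and, far from [A], by the partition of unity of a shrinking
     of the cover by the sets [f i > 0]; the empty intersection keeps the map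
     on the boundary of the simplex.
   - If [asdim X <= n], uniformly bounded covers of larger and larger scale are
     glued along annuli and their members coloured by members of [G].
   - If [X] is shrinkable and [asdim X <= N], all coarse covers by finitely many
     sets shrink to multiplicity [n + 1]. This is applied to the [N + 1] colour
     classes of bounded, uniformly separated pieces provided by [asdim X <= N],
     the scale being constant on annuli and tending to infinity. *)

Require Import Defs.
From mathcomp Require Import all_boot all_order all_algebra.
From mathcomp Require Import all_classical all_reals all_analysis.
From mathcomp Require Import unstable ring lra.

Set Implicit Arguments.
Unset Strict Implicit.
Unset Printing Implicit Defensive.

Import Order.TTheory GRing.Theory Num.Theory.

Local Open Scope classical_set_scope.
Local Open Scope ring_scope.
Local Open Scope card_scope.

(** * Slow oscillation and coarse covers *)

Section at_infinity.
Context {R : realType} {X : metricType R} (x0 : X).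
Implicit Types (P : set X) (u v : X -> R).

(** The neighbourhoods of infinity; for bounded [X] this filter is improper and all [\near]
    statements hold vacuously. *)
Definition far : set_system X :=
  [set P | exists N : R, forall x, N < mdist x0 x -> P x].

Global Instance far_filter : Filter far.
Proof.
split; first by exists 0.
- move=> P Q [M PM] [N QN]; exists (Num.max M N) => x.
  by rewrite gt_max => /andP[? ?]; split; [exact: PM|exact: QN].
- by move=> P Q PQ [N PN]; exists N => x /PN /PQ.
Qed.

Lemma far_gt (M : R) : \forall x \near far, M < mdist x0 x.
Proof. by exists M. Qed.

Definition slow u : Prop := forall r e : R, 0 < r -> 0 < e ->
  \forall x \near far, forall y, mdist x y < r -> `|u x - u y| < e.

Definition coarse_cover (I : finType) (G : I -> set X) : Prop :=
  forall r : R, 0 < r ->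
    \forall x \near far, exists i, forall y, mdist x y < r -> G i y.

(** Multiplied by [v x], the difference of the quotients is [(u x - u y) + u y / v y * (v y - v x)],
    at most [(a + b) * r] in absolute value, while [v x] tends to infinity. *)
Lemma slow_ratio u v (a b : R) : 0 <= a -> 0 <= b ->
  (forall x y, u x <= u y + a * mdist x y) ->
  (forall x y, v x <= v y + b * mdist x y) ->
  (forall x, 0 <= u x <= v x) ->
  (forall M, \forall x \near far, M < v x) ->
  slow (fun x => u x / v x).
Proof.
move=> a0 b0 ulip vlip uv vinf r e r0 e0.
have := vinf ((a + b) * r / e + b * r); apply: filterS => x vx y xy.
have d0 := mdist_ge0 x y.
have br : 0 <= b * r by rewrite mulr_ge0 // ltW.
have ar : 0 <= (a + b) * r by rewrite mulr_ge0 ?addr_ge0 // ltW.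
have are : 0 <= (a + b) * r / e by rewrite divr_ge0 // ltW.
have ad : a * mdist x y <= a * r by rewrite ler_wpM2l // ltW.
have bd : b * mdist x y <= b * r by rewrite ler_wpM2l // ltW.
have vx0 : 0 < v x by lra.
have vy0 : 0 < v y by have := vlip x y; lra.
have /andP[uy0 uvy] := uv y.
have [u1 u2 v1 v2] : [/\ u x <= u y + a * r, u y <= u x + a * r,
  v x <= v y + b * r & v y <= v x + b * r].
  have := (ulip x y, ulip y x, vlip x y, vlip y x).
  by rewrite (metric_sym y x) => -[[[? ?] ?] ?]; split; lra.
have q01 : 0 <= u y / v y <= 1.
  by rewrite divr_ge0 ?(ltW vy0) //= ler_pdivrMr // mul1r.
have E : (u x / v x - u y / v y) * v x = (u x - u y) + u y / v y * (v y - v x).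
  by rewrite mulrBr divfK ?gt_eqF // mulrBl divfK ?gt_eqF //; lra.
have qb : `|u y / v y * (v y - v x)| <= b * r.
  rewrite normrM ger0_norm; last by case/andP: q01.
  apply: (@le_trans _ _ `|v y - v x|).
    by rewrite ler_piMl //; case/andP: q01.
  by rewrite ler_norml; apply/andP; split; lra.
have uab : `|u x - u y| <= a * r by rewrite ler_norml; apply/andP; split; lra.
rewrite -(ltr_pM2r vx0) -[X in `|_| * X](gtr0_norm vx0) -normrM E.
apply: (le_lt_trans (ler_normD _ _)).
apply: (@le_lt_trans _ _ ((a + b) * r)); first by rewrite mulrDl lerD.
by rewrite [ltRHS]mulrC -ltr_pdivrMr //; lra.
Qed.

(* The distance to the complement of [U], truncated at [c]. *)
Definition depth (c : X -> R) (U : set X) (x : X) : R :=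
  inf [set (if `[< U y >] then c x else Num.min (mdist x y) (c x)) | y in setT].

Section depth.
Variables (c : X -> R) (U : set X).
Hypothesis c_ge0 : forall x, 0 <= c x.

Let D x y := if `[< U y >] then c x else Num.min (mdist x y) (c x).

Let D_ge0 x y : 0 <= D x y.
Proof. by rewrite /D; case: ifP => // _; rewrite le_min mdist_ge0 c_ge0. Qed.

Let D_inf x : has_inf [set D x y | y in setT].
Proof. by split; [exists (D x x), x|exists 0 => _ [y _ <-]]. Qed.

Let depth_leD x y : depth c U x <= D x y.
Proof. by apply: ge_inf; [exact: (D_inf x).2|exists y]. Qed.

Let depth_lb x t : (forall y, t <= D x y) -> t <= depth c U x.
Proof.
by move=> tD; apply: lb_le_inf; [exact: (D_inf x).1|move=> _ [y _ <-]; exact: tD].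
Qed.

Lemma depth_ge0 x : 0 <= depth c U x.
Proof. exact: depth_lb. Qed.

Lemma depth_le x : depth c U x <= c x.
Proof.
apply: le_trans (depth_leD x x) _; rewrite /D; case: ifP => // _.
by rewrite ge_min lexx orbT.
Qed.

Lemma depth_le_dist x y : ~ U y -> depth c U x <= mdist x y.
Proof.
move=> Uy; apply: le_trans (depth_leD x y) _; rewrite /D.
by case: asboolP => // _; rewrite ge_min lexx.
Qed.

Lemma depth_out x : ~ U x -> depth c U x = 0.
Proof.
move=> /(@depth_le_dist x); rewrite mdistxx => d0.
by apply/eqP; rewrite eq_le d0 depth_ge0.
Qed.

Lemma depth_gt0 x : 0 < depth c U x -> U x.
Proof. by move=> d0; apply: contrapT => /depth_out d; rewrite d ltxx in d0. Qed.

Lemma depth_ball x t : t <= c x -> (forall y, mdist x y < t -> U y) ->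
  t <= depth c U x.
Proof.
move=> tc tU; apply: depth_lb => y; rewrite /D; case: asboolP => // Uy.
by rewrite le_min tc andbT leNgt; apply/negP => /tU.
Qed.

Lemma depth_lip : (forall x y, c x <= c y + mdist x y) ->
  forall x y, depth c U x <= depth c U y + mdist x y.
Proof.
move=> clip x y; rewrite -lerBlDr; apply: depth_lb => z; rewrite lerBlDr.
apply: le_trans (depth_leD x z) _; rewrite /D; case: ifP => // _.
have := metric_triangle x y z; have := clip x y.
case: (leP (mdist y z) (c y)) => _ h1 h2; rewrite ge_min; apply/orP.
  by left; lra.
by right; lra.
Qed.

End depth.

(** The depths in the [G i] are divided by their sum, which tends to infinity since large balls lie
    in some [G i]. Truncating at [mdist x0] keeps them 1-Lipschitz, and finite even if [G i] is the
    whole space. *)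
Lemma coarse_cover_partition (I : finType) (G : I -> set X) : coarse_cover G ->
  exists p : I -> X -> R, [/\ forall i, slow (p i), forall i x, 0 <= p i x,
    forall i x, 0 < p i x -> G i x & \forall x \near far, \sum_i p i x = 1].
Proof.
move=> Gcov; pose u i := depth (mdist x0) (G i); pose v x := \sum_i u i x.
have c0 x : 0 <= mdist x0 x by exact: mdist_ge0.
have ulip i x y : u i x <= u i y + mdist x y.
  apply: depth_lip => // {}x {}y.
  by have := metric_triangle x0 y x; rewrite (metric_sym y x).
have u0 i x : 0 <= u i x by exact: depth_ge0.
have uv i x : u i x <= v x.
  by rewrite /v (bigD1 i) //= lerDl sumr_ge0.
have vinf M : \forall x \near far, M < v x.
  have M1 : 0 < Num.max M 0 + 1.
    by rewrite ltr_wpDl // le_max lexx orbT.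
  have := Gcov _ M1; have := far_gt (Num.max M 0 + 1).
  apply: filterS2 => x /ltW xM [i xi].
  have := uv i x; have := depth_ball c0 xM xi.
  have : M <= Num.max M 0 by rewrite le_max lexx.
  rewrite -/(u i x); lra.
have v0 : \forall x \near far, 0 < v x by exact: vinf.
exists (fun i x => u i x / v x); split.
- move=> i; apply: (@slow_ratio _ _ 1 #|I|%:R) => //.
  + by move=> x y; rewrite mul1r.
  + move=> x y; rewrite mulr_natl -sumr_const /v -big_split /=.
    by apply: ler_sum => j _; exact: ulip.
  + by move=> x; rewrite u0 uv.
- by move=> i x; rewrite divr_ge0 // (le_trans (u0 i x)).
- move=> i x; case: (eqVneq (u i x) 0) => [->|u1 _]; first by rewrite mul0r ltxx.
  by apply: (@depth_gt0 (mdist x0)) => //; rewrite lt_neqAle eq_sym u1 u0.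
- by apply: filterS v0 => x vx; rewrite -mulr_suml divff // gt_eqF.
Qed.

End at_infinity.

(** * Maps to the sphere *)

Section diameter.
Context {R : realType} {X : metricType R}.
Implicit Types (A : set X).

Lemma mdist_le_diam A x y : A x -> A y -> ((mdist x y)%:E <= diam A)%E.
Proof.
move=> Ax Ay; rewrite /diam le_max; apply/orP; right.
by apply: ereal_sup_ubound; exists (x, y).
Qed.

Lemma diam_le A (D : R) : 0 <= D ->
  (forall x y, A x -> A y -> mdist x y <= D) -> (diam A <= D%:E)%E.
Proof.
move=> D0 AD; rewrite /diam ge_max lee_fin D0; apply: ge_ereal_sup.
by move=> _ [[x y] [/= Ax Ay] <-]; rewrite lee_fin AD.
Qed.

End diameter.

Section far_properties.
Context {R : realType} {X : metricType R} (x0 : X).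

Lemma far_ball (P : set X) (r : R) : far x0 P ->
  \forall x \near far x0, forall y, mdist x y < r -> P y.
Proof.
move=> [N PN]; exists (N + r) => x xN y xy; apply: PN.
by have := metric_triangle x0 y x; rewrite (metric_sym y x); lra.
Qed.

(* Stated along an isometric embedding [v], to cover both [X] and its
   subsets. *)
Lemma slowly_oscillatingP (Z Y : metricType R) (v : Z -> X)
    (v_iso : forall a b, mdist (v a) (v b) = mdist a b) (f : Z -> Y) :
  slowly_oscillating f <-> forall r e : R, 0 < r -> 0 < e ->
    \forall x \near far x0, forall a b,
      mdist x (v a) < r -> mdist x (v b) < r -> mdist (f a) (f b) < e.
Proof.
split=> [fso r e r0 e0|fso z0 r e r0 e0].
  have [[a0]|noZ] := pselect (inhabited Z); last first.
    by exists 0 => x _ a; case: noZ.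
  have [|N N0 Nf] := fso a0 (r + r) e _ e0; first by rewrite addr_gt0.
  exists (N + mdist x0 (v a0) + r) => x xN a b xa xb.
  have aN : N < mdist a0 a.
    rewrite -v_iso; have := metric_triangle x0 (v a0) (v a).
    by have := metric_triangle x0 (v a) x; rewrite (metric_sym (v a) x); lra.
  rewrite -lte_fin; apply: le_lt_trans (Nf _ aN); apply: mdist_le_diam.
    by exists a => //; rewrite ballEmdist /= mdistxx addr_gt0.
  exists b => //; rewrite ballEmdist /= -v_iso.
  by have := metric_triangle (v a) x (v b); rewrite (metric_sym _ x); lra.
(* Strict bounds on distances bound the diameter only weakly, hence [e / 2]. *)
have [|N Nf] := fso r (e / 2) r0; first by rewrite divr_gt0.
exists (Num.max 1 (N + mdist x0 (v z0))); first by rewrite lt_max ltr01.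
move=> z; rewrite gt_max => /andP[_ zN].
apply: (@le_lt_trans _ _ (e / 2)%:E); last by rewrite lte_fin; lra.
apply: diam_le => [|_ _ [a za <-] [b zb <-]]; first by rewrite divr_ge0 // ltW.
move: za zb; rewrite ballEmdist /= -!v_iso => za zb.
apply: ltW; apply: Nf za zb.
have := metric_triangle (v z0) x0 (v z).
by rewrite v_iso (metric_sym _ x0); lra.
Qed.

End far_properties.

Section sphere_theory.
Context {R : realType} {n : nat}.
Implicit Types (s t : sphere R n) (p : 'I_n.+2 -> R).

Lemma sphere_coord_ge0 s i : 0 <= sphere_val s 0 i.
Proof. by case: s => s /= /andP[/andP[/forallP]]. Qed.

Lemma sphere_coord_sum s : \sum_i sphere_val s 0 i = 1.
Proof. by case: s => s /= /andP[/andP[_ /eqP]]. Qed.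

Lemma sphere_coord_eq0 s : exists i, sphere_val s 0 i = 0.
Proof. by case: s => s /= /andP[_ /existsP[i /eqP]]; exists i. Qed.

Lemma sphere_coord_le1 s i : sphere_val s 0 i <= 1.
Proof.
rewrite -(sphere_coord_sum s) (bigD1 i) //= lerDl sumr_ge0 // => j _.
exact: sphere_coord_ge0.
Qed.

Lemma sphere_coord_large s : exists i, n.+2%:R^-1 <= sphere_val s 0 i.
Proof.
apply: contrapT => /forallNP small.
have : \sum_i sphere_val s 0 i < \sum_(i < n.+2) n.+2%:R^-1.
  by apply: ltr_sum; [apply/hasP; exists ord0; rewrite ?mem_index_enum|
    move=> i _; rewrite ltNge; apply/negP/small].
by rewrite sphere_coord_sum sumr_const card_ord -[_ *+ _]mulr_natr mulVf // ltxx.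
Qed.

Lemma ler_sphere_coord s t i :
  `|sphere_val s 0 i - sphere_val t 0 i| <= mdist s t.
Proof.
by rewrite /mdist /= /l1_dist (bigD1 i) //= lerDl sumr_ge0.
Qed.

Lemma sphere_mdist_le s t (e : R) :
  (forall i, `|sphere_val s 0 i - sphere_val t 0 i| <= e) ->
  mdist s t <= n.+2%:R * e.
Proof.
move=> ste; rewrite /mdist /= /l1_dist mulr_natl -[X in _ *+ X]card_ord.
by rewrite -sumr_const; apply: ler_sum => i _.
Qed.

Lemma simplex_boundaryP p : (forall i, 0 <= p i) -> \sum_i p i = 1 ->
  (exists i, p i = 0) -> simplex_boundary (\row_i p i).
Proof.
move=> p0 p1 [i pi]; apply/andP; split; [apply/andP; split|].
- by apply/forallP => j; rewrite mxE.
- by apply/eqP; rewrite -p1; apply: eq_bigr => j _; rewrite mxE.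
- by apply/existsP; exists i; rewrite mxE pi.
Qed.

Lemma vertex_boundary :
  simplex_boundary (\row_(i < n.+2) (i == ord0)%:R : 'rV[R]_n.+2).
Proof.
apply: simplex_boundaryP => [i||]; first by rewrite ler0n.
- by rewrite (bigD1 ord0) //= big1 ?addr0 // => i /negbTE ->.
- by exists ord_max.
Qed.

(** Rows off the boundary are sent to a default vertex. *)
Definition to_sphere p : sphere R n :=
  insubd (Sphere vertex_boundary) (\row_i p i).

Lemma to_sphereE p i : simplex_boundary (\row_i p i) ->
  sphere_val (to_sphere p) 0 i = p i.
Proof.
move=> pb; have -> : sphere_val (to_sphere p) = \row_i p i by exact: insubdK.
by rewrite mxE.
Qed.

Lemma to_sphereK s : to_sphere (fun i => sphere_val s 0 i) = s.
Proof.
rewrite /to_sphere (_ : (\row_i _) = val s) ?valKd //.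
by apply/rowP => i; rewrite mxE.
Qed.

Context {X : metricType R} (x0 : X).

Lemma slow_sphere_coord (g : X -> sphere R n) i : slowly_oscillating g ->
  slow x0 (fun x => sphere_val (g x) 0 i).
Proof.
move=> /(@slowly_oscillatingP R X x0 X _ id (fun _ _ => erefl)) gso r e r0 e0.
have := gso _ _ r0 e0; apply: filterS => x xg y xy.
by apply: le_lt_trans (ler_sphere_coord _ _ _) (xg _ _ _ xy); rewrite mdistxx.
Qed.

Lemma slowly_oscillating_sphere (Z : metricType R) (v : Z -> X)
    (v_iso : forall a b, mdist (v a) (v b) = mdist a b)
    (f : Z -> sphere R n) (p : 'I_n.+2 -> X -> R) :
  (forall i, slow x0 (p i)) ->
  (\forall x \near far x0, forall a, v a = x ->
     forall i, sphere_val (f a) 0 i = p i x) ->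
  slowly_oscillating f.
Proof.
move=> pslow fp; apply/(slowly_oscillatingP x0 v_iso) => r e r0 e0.
(* Each of the [n.+2] coordinates contributes at most [2 * e'], in total [e / 2]. *)
pose e' := e / (4 * n.+2%:R).
have e'0 : 0 < e' by rewrite divr_gt0 // mulr_gt0.
have pe : \forall x \near far x0, forall i, forall y,
    mdist x y < r -> `|p i x - p i y| < e'.
  by apply: filter_forall => i; exact: (pslow i _ _ r0 e'0).
apply: filterS (filterI pe (far_ball r fp)) => x [xp xf] a b xa xb.
apply: (@le_lt_trans _ _ (n.+2%:R * (e' + e'))).
  apply: sphere_mdist_le => i.
  rewrite (xf _ xa a erefl) (xf _ xb b erefl).
  have := ler_distD (p i x) (p i (v a)) (p i (v b)).
  have := xp i _ xa; have := xp i _ xb.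
  by rewrite (distrC (p i (v a)) (p i x)); lra.
have -> : n.+2%:R * (e' + e') = e / 2.
  have : n.+2%:R != 0 :> R by rewrite pnatr_eq0.
  by rewrite /e'; move: n.+2%:R => N N0; field.
lra.
Qed.

End sphere_theory.

(** * From extensors to shrinkings *)

Section shrinkable.
Context {R : realType} {X : metricType R} (x0 : X).

Definition shrinkable (n : nat) : Prop :=
  forall G : 'I_n.+2 -> set X, coarse_cover x0 G ->
  exists H : 'I_n.+2 -> set X, [/\ coarse_cover x0 H,
    forall i, H i `<=` G i & forall x, exists i, ~ H i x].

Lemma extensor_shrinkable n :
  large_scale_absolute_extensor (sphere R n) X -> shrinkable n.
Proof.
move=> ext G /coarse_cover_partition[p [pslow p0 pG psum]].
pose A := [set x : X | simplex_boundary (\row_i p i x)].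
have Aiso (a b : A) : mdist (set_val a) (set_val b) = mdist a b by [].
pose f (a : A) : sphere R n := to_sphere (fun i => p i (set_val a)).
have fE (a : A) i : sphere_val (f a) 0 i = p i (set_val a).
  by rewrite to_sphereE //; exact: (set_valP a).
have fso : slowly_oscillating f.
  apply: (slowly_oscillating_sphere Aiso pslow).
  by apply: filterE => x a <- i; exact: fE.
have [g gso gf] := ext A f fso.
have gG : \forall x \near far x0, forall i, 0 < sphere_val (g x) 0 i -> G i x.
  apply: filterS psum => x px i.
  have [xA|xA] := pselect (A x).
    have := gf (exist _ x (mem_set xA)); rewrite /= => ->.
    by rewrite fE; exact: pG.
  (* Off [A], no [p i x] vanishes, since otherwise [x] would be mapped to the boundary. *)
  move=> _; apply: pG; rewrite lt_neqAle p0 andbT eq_sym; apply/eqP => pi0.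
  by apply: xA; apply: simplex_boundaryP => //; exists i.
exists (fun i => [set x | G i x /\ 0 < sphere_val (g x) 0 i]); split.
- move=> r r0.
  have gs : \forall x \near far x0, forall i, forall y, mdist x y < r ->
      `|sphere_val (g x) 0 i - sphere_val (g y) 0 i| < n.+2%:R^-1.
    by apply: filter_forall => i; apply: slow_sphere_coord => //; rewrite invr_gt0.
  apply: filterS (filterI gs (far_ball r gG)) => x [xg xG].
  have [i gi] := sphere_coord_large (g x); exists i => y xy.
  (* This coordinate is at least [n.+2%:R^-1] at [x] and varies by less over the ball. *)
  suff gy : 0 < sphere_val (g y) 0 i by split=> //; exact: xG.
  by have := xg i _ xy; rewrite ltr_norml => /andP[_]; move: (_^-1) gi => c; lra.
- by move=> i x [].
- by move=> x; have [i gi] := sphere_coord_eq0 (g x); exists i; rewrite /= gi ltxx => -[].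
Qed.

End shrinkable.

(** * From shrinkings to extensors *)

Section shrinkable_extensor.
Context {R : realType} {X : metricType R} (x0 : X).

(* A diagonal argument: [rho x] stays below the last [k] for which [P k x] is
   known to hold. *)
Lemma diagonal_scale (P : nat -> set X) : (forall k, far x0 (P k)) ->
  exists rho : X -> R, [/\ forall x, 0 <= rho x,
    forall x y, rho x <= rho y + mdist x y,
    forall M, \forall x \near far x0, M < rho x &
    forall x, 0 < rho x -> exists2 k, rho x <= k.+1%:R & P k x].
Proof.
move=> /choice[N PN].
(* Each [w] is 1-Lipschitz in [x], hence so is the infimum [rho]; and [rho x > k] forces [x] beyond
   [N k]. *)
pose w x k : R := k%:R + Num.max 0 (mdist x0 x - N k).
have w0 x k : 0 <= w x k by rewrite addr_ge0 // le_max lexx.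
have winf x : has_inf [set w x k | k in setT].
  by split; [exists (w x 0%N), 0%N|exists 0 => _ [k _ <-]].
pose rho x := inf [set w x k | k in setT].
have rho_le x k : rho x <= w x k by apply: ge_inf; [exact: (winf x).2|exists k].
have le_rho x t : (forall k, t <= w x k) -> t <= rho x.
  by move=> tw; apply: lb_le_inf; [exact: (winf x).1|move=> _ [k _ <-]; exact: tw].
exists rho; split.
- by move=> x; exact: le_rho.
- move=> x y; rewrite -lerBlDr; apply: le_rho => k; rewrite lerBlDr.
  apply: le_trans (rho_le x k) _; rewrite /w.
  have := metric_triangle x0 y x; rewrite (metric_sym y x).
  have := mdist_ge0 x y.
  case: (leP 0 (mdist x0 x - N k)); case: (leP 0 (mdist x0 y - N k)); lra.
- move=> M; pose K := Num.bound (M + 1).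
  have MK : M + 1 < K%:R by exact: ltr_bound.
  have : \forall x \near far x0, forall k : 'I_K, N k + (M + 1) < mdist x0 x.
    by apply: filter_forall => k; exact: far_gt.
  apply: filterS => x xN; apply: (@lt_le_trans _ _ (M + 1)); first lra.
  apply: le_rho => k; rewrite /w.
  have [kK|Kk] := ltnP k K; last first.
    have : K%:R <= k%:R :> R by rewrite ler_nat.
    have : 0 <= Num.max 0 (mdist x0 x - N k) by rewrite le_max lexx.
    lra.
  have := xN (Ordinal kK); rewrite /=.
  have : mdist x0 x - N k <= Num.max 0 (mdist x0 x - N k).
    by rewrite le_max lexx orbT.
  have : 0 <= k%:R :> R by [].
  lra.
- move=> x rx0.
  have ex : exists m, rho x <= m%:R.
    by exists (Num.bound (rho x)); rewrite ltW // ltr_bound.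
  case: (ex_minnP ex) => -[|k] rk kmin; first by rewrite leNgt rx0 in rk.
  exists k => //; apply: PN.
  have : k%:R < rho x by rewrite ltNge; apply/negP => /kmin; rewrite ltnn.
  have := rho_le x k; rewrite /w.
  case: (leP 0 (mdist x0 x - N k)) => h1 h2 h3; last lra.
  by lra.
Qed.

Lemma ltr_dist_mul (a b c d e : R) : 0 <= a <= 1 -> 0 <= d <= 1 ->
  `|a - b| < e -> `|c - d| < e -> `|a * c - b * d| < e + e.
Proof.
move=> /andP[a0 a1] /andP[d0 d1] ab cd.
have -> : a * c - b * d = a * (c - d) + d * (a - b) by ring.
apply: (le_lt_trans (ler_normD _ _)); rewrite !normrM (ger0_norm a0) (ger0_norm d0).
apply: (@le_lt_trans _ _ (`|c - d| + `|a - b|)); last by rewrite addrC ltrD.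
by rewrite lerD // ler_piMl.
Qed.

Lemma shrinkable_extensor n :
  shrinkable x0 n -> large_scale_absolute_extensor (sphere R n) X.
Proof.
move=> shr A f fso.
have Aiso (a b : A) : mdist (set_val a) (set_val b) = mdist a b by [].
(* If [r < rho x], a point [y] within [r] of [x] will use a point of [A] within [rho y < 2 * rho x],
   hence within [3 * rho x] of [x]; the factor 4 allows for this. *)
have [rho [rho0 rholip rhoinf rhoP]] : exists rho : X -> R,
    [/\ forall x, 0 <= rho x, forall x y, rho x <= rho y + mdist x y,
    forall M, \forall x \near far x0, M < rho x &
    forall x, 0 < rho x -> exists2 k, rho x <= k.+1%:R & forall a b : A,
      mdist x (set_val a) < 4 * k.+1%:R -> mdist x (set_val b) < 4 * k.+1%:R ->
      mdist (f a) (f b) < k.+1%:R^-1].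
  apply: (@diagonal_scale (fun k x => forall a b : A,
    mdist x (set_val a) < 4 * k.+1%:R -> mdist x (set_val b) < 4 * k.+1%:R ->
    mdist (f a) (f b) < k.+1%:R^-1)) => k.
  by apply: ((slowly_oscillatingP x0 Aiso f).1 fso); rewrite ?invr_gt0 ?mulr_gt0.
(* [D] is the distance to [A] truncated at [rho]; [tau] vanishes on [A] and is 1 at distance at
   least [rho > 0] from it. *)
pose D := depth rho (~` A); pose tau x := D x / rho x.
have D0 x : 0 <= D x by exact: depth_ge0.
have Drho x : D x <= rho x by exact: depth_le.
have tau01 x : 0 <= tau x <= 1.
  rewrite /tau divr_ge0 //=; have [->|r1] := eqVneq (rho x) 0.
    by rewrite invr0 mulr0.
  by rewrite ler_pdivrMr ?mul1r // lt_neqAle eq_sym r1 rho0.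
have tau1 x : 0 < rho x -> ~ D x < rho x -> tau x = 1.
  move=> rx /negP; rewrite -leNgt => rD; rewrite /tau.
  have DE : D x = rho x by apply/eqP; rewrite eq_le Drho.
  by rewrite DE divff // gt_eqF.
have tau_slow : slow x0 tau.
  apply: (@slow_ratio _ _ _ _ _ 1 1) => // [x y|x y|x]; rewrite ?mul1r ?D0 ?Drho //.
  exact: depth_lip.
(* A point of [A] chooses itself, a point near [A] a point of [A] closer than [rho], any other point
   the default vertex. *)
have /choice[q qP] : forall x, exists s : sphere R n,
    (forall a : A, set_val a = x -> s = f a) /\
    (D x < rho x -> exists2 a : A, mdist x (set_val a) < rho x & s = f a).
  move=> x; have [xA|xA] := pselect (A x).
    exists (f (exist _ x (mem_set xA))); split.
      by move=> a ax; congr (f _); exact/val_inj/esym.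
    move=> Dr; exists (exist _ x (mem_set xA)) => //.
    by rewrite mdistxx (le_lt_trans (D0 x)).
  have [Dr|Dr] := pselect (D x < rho x); last first.
    exists (Sphere (vertex_boundary (n := n))); split => // a ax.
    by case: xA; rewrite -ax; exact: set_valP.
  have [y yA xy] : exists2 y, A y & mdist x y < rho x.
    apply: contrapT => noy; move: Dr; apply/negP; rewrite -leNgt.
    by apply: depth_ball => // y xy Ay; apply: noy; exists y.
  exists (f (exist _ y (mem_set yA))); split.
    by move=> a ax; case: xA; rewrite -ax; exact: set_valP.
  by move=> _; exists (exist _ y (mem_set yA)).
have q_close r e : 0 < r -> 0 < e -> \forall x \near far x0, forall y z,
    mdist x y < r -> mdist x z < r -> D y < rho y -> D z < rho z ->
    mdist (q y) (q z) < e.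
  move=> r0 e0; apply: filterS (rhoinf (r + e^-1)) => x rx y z xy xz Dy Dz.
  have e1 : 0 < e^-1 by rewrite invr_gt0.
  have [|k rk Pk] := rhoP x; first lra.
  have [a ya ->] := (qP y).2 Dy; have [b zb ->] := (qP z).2 Dz.
  have ek : k.+1%:R^-1 <= e.
    by rewrite -[leRHS]invrK lef_pV2 ?posrE //; lra.
  apply: lt_le_trans ek; apply: Pk.
    have := metric_triangle x y (set_val a).
    by have := rholip y x; rewrite (metric_sym y x); lra.
  have := metric_triangle x z (set_val b).
  by have := rholip z x; rewrite (metric_sym z x); lra.
(* Points where [q] is arbitrary lie in every [G i], so only values of [f] constrain the cover. *)
pose G i := [set x | D x < rho x -> 0 < sphere_val (q x) 0 i].
have Gcov : coarse_cover x0 G.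
  move=> r r0; have n0 : 0 < n.+2%:R^-1 :> R by rewrite invr_gt0.
  apply: filterS (q_close _ _ r0 n0) => x qx.
  have [[z xz Dz]|noz] := pselect (exists2 z, mdist x z < r & D z < rho z).
    have [i qi] := sphere_coord_large (q z); exists i => y xy Dy.
    have := le_lt_trans (ler_sphere_coord _ _ i) (qx y z xy xz Dy Dz).
    rewrite ltr_norml => /andP[+ _]; move: (_^-1) qi => c; lra.
  by exists ord0 => y xy Dy; case: noz; exists y.
have [H [/coarse_cover_partition[p [pslow p0 pH psum]] HG H0]] := shr G Gcov.
pose k i x := (1 - tau x) * sphere_val (q x) 0 i + tau x * p i x.
have k_slow i : slow x0 (k i).
  move=> r e r0 e0.
  have e40 : 0 < e / 4 by rewrite divr_gt0.
  apply: filterS (filterI (filterI (tau_slow _ _ r0 e40) (pslow i _ _ r0 e40))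
    (filterI (q_close _ _ r0 e40) (filterI (far_ball r psum)
      (far_ball r (rhoinf 0))))) => x [[xtau xp] [xq [xsum xrho]]] y xy.
  have xx : mdist x x < r by rewrite mdistxx.
  have py1 : 0 <= p i y <= 1.
    rewrite p0 -(xsum y xy) (bigD1 i) //= lerDl sumr_ge0 // => j _.
  have qz1 z : 0 <= sphere_val (q z) 0 i <= 1.
    by rewrite sphere_coord_ge0 sphere_coord_le1.
  have xytau := xtau y xy.
  have := ltr_dist_mul (tau01 x) py1 xytau (xp y xy).
  suff : `|(1 - tau x) * sphere_val (q x) 0 i - (1 - tau y) * sphere_val (q y) 0 i|
      < e / 4 + e / 4.
    move=> h1 h2; rewrite /k opprD addrACA; apply: (le_lt_trans (ler_normD _ _)).
    by lra.
  have bound u v z : `|u - v| < e / 4 -> `|(u - v) * sphere_val (q z) 0 i| < e / 4 + e / 4.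
    move=> uv; have /andP[q0 q1] := qz1 z.
    rewrite normrM (ger0_norm q0); apply: (@le_lt_trans _ _ `|u - v|); last lra.
    by rewrite ler_piMr.
  (* Where [D] equals [rho], the factor [1 - tau] vanishes and cancels the arbitrary value of
     [q]. *)
  have [Dx|/(tau1 x (xrho x xx)) tx] := pselect (D x < rho x); last first.
    by rewrite tx subrr mul0r sub0r normrN -[X in X - tau y]tx; exact: bound.
  have [Dy|/(tau1 y (xrho y xy)) ty] := pselect (D y < rho y); last first.
    by rewrite ty subrr mul0r subr0 -[X in X - tau x]ty; apply: bound; rewrite distrC.
  apply: ltr_dist_mul => //.
  - by have /andP[? ?] := tau01 x; apply/andP; split; lra.
  - have -> : 1 - tau x - (1 - tau y) = - (tau x - tau y) by lra.
    by rewrite normrN.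
  - exact: le_lt_trans (ler_sphere_coord _ _ _) (xq x y xx xy Dx Dy).
exists (fun x => to_sphere (fun i => k i x)).
  apply: (@slowly_oscillating_sphere _ _ _ x0 X id _ _ k) => //.
  apply: filterS (filterI psum (rhoinf 0)) => x [xsum xrho] _ -> i.
  have /andP[t0 t1] := tau01 x.
  apply: to_sphereE; apply: simplex_boundaryP.
  - by move=> j; rewrite /k addr_ge0 // mulr_ge0 ?sphere_coord_ge0 ?subr_ge0.
  - by rewrite big_split -!mulr_sumr /= sphere_coord_sum xsum !mulr1 subrK.
  (* Near [A], a zero coordinate [j] of [q x] puts [x] outside [G j], so [p j x] vanishes too;
     elsewhere [tau x = 1] and some [H j] misses [x]. *)
  - have [Dx|/(tau1 x xrho) tx] := pselect (D x < rho x).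
      have [j qj] := sphere_coord_eq0 (q x); exists j.
      rewrite /k qj mulr0 add0r; have [->|pj] := eqVneq (p j x) 0; rewrite ?mulr0 //.
      have /pH/HG/(_ Dx) : 0 < p j x by rewrite lt_neqAle eq_sym pj p0.
      by rewrite qj ltxx.
    have [j Hj] := H0 x; exists j; rewrite /k tx subrr mul0r add0r mul1r.
    apply/eqP; rewrite eq_le p0 andbT leNgt; apply/negP => /pH.
    exact: Hj.
move=> a; have Da : D (set_val a) = 0.
  by apply: depth_out => //; apply; exact: set_valP.
have -> : (fun i => k i (set_val a)) = fun i => sphere_val (f a) 0 i.
  apply/funext => i; rewrite /k /tau Da mul0r subr0 mul1r mul0r addr0.
  by rewrite ((qP (set_val a)).1 a erefl).
exact: to_sphereK.
Qed.

End shrinkable_extensor.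

(** * Covers of bounded multiplicity *)

Section families_of_sets.
Context {R : realType} {X : metricType R}.

Lemma card_pigeonhole (T : Type) (S : set T) (k : nat) (v : 'I_k.+1 -> T) :
  S #<= `I_k -> injective v -> ~ forall i, S (v i).
Proof.
move=> /pcard_leP[f] vinj Sv.
have fk i : (f (v i) < k)%N.
  by have fS : set_fun S `I_k f by []; exact: (fS (v i) (Sv i)).
have : injective (fun i => Ordinal (fk i)).
  move=> i j [] fij; apply: vinj; apply: inj fij; exact/mem_set.
by move/leq_card; rewrite !card_ord ltnn.
Qed.

Definition bounded_family (D : R) (U : set (set X)) : Prop :=
  forall V, U V -> forall x y, V x -> V y -> mdist x y <= D.

(** The balls are those of [X], not of [S], which lets the families of different sets be glued. *)
Definition cover_at (n : nat) (l D : R) (S : set X) : Prop :=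
  exists U : set (set X), [/\ bounded_family D U, dim_le U n &
    forall x, S x -> exists2 V, U V & forall y, mdist x y < l -> V y].

Lemma cover_atS n (l l' D D' : R) (S S' : set X) : l' <= l -> D <= D' ->
  S' `<=` S -> cover_at n l D S -> cover_at n l' D' S'.
Proof.
move=> ll DD SS [U [UD Un US]]; exists U; split => //.
  by move=> V UV x y Vx Vy; exact: le_trans (UD V UV x y Vx Vy) DD.
move=> x /SS /US[V UV xV]; exists V => // y xy; apply: xV.
exact: lt_le_trans xy ll.
Qed.

Lemma asdim_leP n :
  asdim_le X n <-> forall l : R, exists D, cover_at n l D setT.
Proof.
split=> [Xn l|Xn l l0].
  (* The Lebesgue number is a supremum, perhaps not attained, so more than [l] is requested. *)
  have [|U [Ucov Ubnd Uleb Udim]] := Xn (Num.max l 0 + 1).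
    by rewrite ltr_wpDl // le_max lexx orbT.
  exists (fine (ereal_sup [set diam V | V in U])), U; split => //.
    move=> V UV x y Vx Vy; have := mdist_le_diam Vx Vy.
    have Vsup : (diam V <= ereal_sup [set diam V | V in U])%E.
      by apply: ereal_sup_ubound; exists V.
    move=> /le_trans/(_ Vsup) xysup; rewrite -lee_fin fineK //.
    rewrite fin_numE; apply/andP; split; last by rewrite lt_eqF.
    by apply/eqP => supE; rewrite supE in xysup.
  have /ereal_sup_gt[_ [r [r0 rU] <-]] : (l%:E < lebesgue_number U)%E.
    apply: lt_le_trans Uleb; rewrite lte_fin.
    by have : l <= Num.max l 0; [rewrite le_max lexx|lra].
  rewrite lte_fin => lr x _; have [V UV xV] := rU x; exists V => // y xy.
  by apply: xV; rewrite ballEmdist /=; exact: lt_trans xy lr.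
have [D [U [UD Udim Ul]]] := Xn l; exists U; split => //.
- rewrite /is_cover -subTset => x _; have [//|V UV xV] := Ul x.
  by exists V => //; apply: xV; rewrite mdistxx.
- apply: (@le_lt_trans _ _ (Num.max 0 D)%:E); last exact: ltry.
  apply: ge_ereal_sup => _ [V UV <-]; apply: diam_le => [|x y Vx Vy].
    by rewrite le_max lexx.
  by rewrite le_max (UD V UV x y Vx Vy) orbT.
- apply: ereal_sup_ubound; exists l => //; split; first exact: ltW.
  move=> x; have [//|V UV xV] := Ul x; exists V => // y.
  by rewrite ballEmdist; exact: xV.
Qed.

End families_of_sets.

(** * From asymptotic dimension to shrinkings *)

Section asdim_shrinkable.
Context {R : realType} {X : metricType R} (x0 : X).

Lemma zone_exists (ra : nat -> R) (t : R) : (forall k, k%:R <= ra k) ->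
  ra 0%N <= t -> exists k, ra k <= t < ra k.+1.
Proof.
move=> rak t0; have ex : exists k, t < ra k.+1.
  exists (Num.bound t); apply: lt_le_trans (ltr_bound t) _.
  by apply: le_trans (rak _); rewrite ler_nat.
case: (ex_minnP ex) => k tk kmin; exists k; rewrite tk andbT.
case: k tk kmin => // k tk kmin; rewrite leNgt; apply/negP => /kmin.
by rewrite ltnn.
Qed.

(* In the zone [ra k <= |x| < ra k.+1] one uses a cover [F k] whose Lebesgue
   number exceeds the size of the members of [F (k - 1)]. A member of [F k]
   reaching the next zone takes the colour of a member of [F k.+1] containing
   it, which makes the colourings of the two zones agree near their common
   boundary; a point still sees at most the [n.+1] colours of the members
   of [F k] containing it. *)
Lemma asdim_shrinkable n : asdim_le X n -> shrinkable x0 n.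
Proof.
move=> /asdim_leP/choice[D0 /choice[F0 F0P]] G Gcov.
have /choice[T TP] : forall r : R, exists N : R, 0 < r -> forall x,
    N < mdist x0 x -> exists i, forall y, mdist x y < r -> G i y.
  by move=> r; have [/Gcov[N PN]|] := pselect (0 < r); [exists N|exists 0].
pose l := fix l k : R := if k is k'.+1 then l k' + `|D0 (l k')| + 1 else 1.
pose d k : R := `|D0 (l k)|; pose F k := F0 (l k).
have d0 k : 0 <= d k by exact: normr_ge0.
have lS k : l k.+1 = l k + d k + 1 by [].
have lk k : k.+1%:R <= l k.
  by elim: k => [//|k IH]; rewrite lS -natr1; have := d0 k; lra.
have Fd k : bounded_family (d k) (F k).
  move=> V UV x y Vx Vy; have [H _ _] := F0P (l k).
  by apply: le_trans (H V UV x y Vx Vy) _; rewrite ler_norm.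
have Fdim k x : [set V | F k V /\ V x] #<= `I_n.+1.
  by have [_ H _] := F0P (l k); exact: H.
have Fl k x : exists2 V, F k V & forall y, mdist x y < l k -> V y.
  by have [_ _ H] := F0P (l k); exact: H.
(* A set of diameter at most [d k] or [d k.+1] with a point beyond radius [b k] lies in some [G i];
   both occur, as [col k] may use a member of [F k.+1]. *)
pose b k : R := `|T (d k + 1)| + `|T (d k.+1 + 1)| + 1.
have b0 k : 0 <= b k by rewrite !addr_ge0.
(* The terms [l] let a small ball meet at most two zones; the terms [d] prevent members of [F k]
   from crossing zone [k]. *)
pose ra := fix ra k : R :=
  if k is k'.+1 then ra k' + d k' + d k + l k + b k else b 0%N.
have raS k : ra k.+1 = ra k + d k + d k.+1 + l k.+1 + b k.+1 by [].
have l0 k : 0 <= l k by exact: le_trans (lk k).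
have ra_b k : b k <= ra k.
  elim: k => [//|k IH]; rewrite raS; move: (b0 k) (d0 k) (d0 k.+1) (l0 k.+1); lra.
have ra_w k : ra k + l k.+1 <= ra k.+1.
  by rewrite raS; move: (b0 k.+1) (d0 k) (d0 k.+1); lra.
have ra_d k : ra k + d k < ra k.+1.
  rewrite raS; move: (b0 k.+1) (d0 k.+1) (lk k.+1).
  by have : 0 < k.+2%:R :> R by []; lra.
have ra_le : {homo ra : i j / (i <= j)%N >-> i <= j}.
  by apply/nondecreasing_seqP => k; apply: le_trans (ra_w k); rewrite lerDl.
have ra_k k : k%:R <= ra k.
  elim: k => [|k IH]; first exact: le_trans (ra_b 0%N).
  rewrite -natr1; have := ra_w k; have := lk k.+1.
  by have : 1 <= k.+2%:R :> R; [rewrite ler1n|lra].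
have /choice[c0 c0P] : forall V : set X, exists i,
    (exists j, V `<=` G j) -> V `<=` G i.
  move=> V; have [[j Vj]|] := pselect (exists j, V `<=` G j); first by exists j.
  by exists ord0.
have /choice[par parP] : forall k, exists f : set X -> set X, forall U,
    F k U -> U !=set0 -> F k.+1 (f U) /\ U `<=` f U.
  move=> k; suff /choice[f fP] : forall U, exists V,
    F k U -> U !=set0 -> F k.+1 V /\ U `<=` V by exists f.
  move=> U; have [[FU [x Ux]]|] := pselect (F k U /\ U !=set0); last first.
    by move=> H; exists set0 => ? ?; case: H.
  have [V FV xV] := Fl k.+1 x; exists V => _ _; split => // y Uy; apply: xV.
  have := Fd k U FU x y Ux Uy; rewrite lS.
  by have := lk k; have : 0 < k.+1%:R :> R by []; lra.
pose outer k (U : set X) := exists2 y, U y & ra k.+1 <= mdist x0 y.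
pose col k U := if `[< outer k U >] then c0 (par k U) else c0 U.
have c0G k j V x : F k V -> V x -> ra j <= mdist x0 x ->
    T (d k + 1) < ra j -> V `<=` G (c0 V).
  move=> FV Vx xj Tj; apply: c0P.
  have [||i xi] := TP (d k + 1) _ x; first by rewrite ltr_wpDl.
    exact: lt_le_trans xj.
  by exists i => y Vy; apply: xi; have := Fd k V FV x y Vx Vy; lra.
have colG k U x : F k U -> U x -> ra k <= mdist x0 x -> G (col k U) x.
  move=> FU Ux xk; rewrite /col; have bk := ra_b k.
  have T1 := ler_norm (T (d k + 1)); have T2 := ler_norm (T (d k.+1 + 1)).
  have T3 := normr_ge0 (T (d k + 1)); have T4 := normr_ge0 (T (d k.+1 + 1)).
  case: ifP => _; last by apply: (@c0G k k U x) => //; move: bk; rewrite /b; lra.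
  have [FV UV] := parP k U FU (ex_intro _ x Ux).
  apply: (@c0G k.+1 k (par k U) x) => //; try exact: UV.
  by move: bk; rewrite /b; lra.
pose H i := [set x | exists k, ra k <= mdist x0 x < ra k.+1 /\
  exists2 U, F k U & U x /\ col k U = i].
exists H; split.
- move=> r r0; pose K := Num.bound (r + r).
  have Kr : r + r < K%:R by exact: ltr_bound.
  exists (ra K + r) => x xK.
  (* Taking the zone of [mdist x0 x - r] places the ball in zones [m] and [m.+1]. *)
  have [|m /andP[mt tm]] := @zone_exists ra (mdist x0 x - r) ra_k.
    by have := ra_le _ _ (leq0n K); lra.
  have Km : (K <= m)%N.
    by rewrite leqNgt; apply/negP => /ra_le /(lt_le_trans tm); lra.
  have lr k : (m <= k)%N -> r + r < l k.
    move=> mk; apply: lt_le_trans (lk k); apply: lt_le_trans Kr _.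
    by rewrite ler_nat ltnW // (leq_ltn_trans Km).
  have ym y : mdist x y < r -> ra m <= mdist x0 y.
    by have := metric_triangle x0 y x; rewrite (metric_sym y x); lra.
  have ym2 y : mdist x y < r -> mdist x0 y < ra m.+2.
    have := metric_triangle x0 x y; have := ra_w m.+1.
    by have := lr m.+2 (leq_trans (leqnSn _) (leqnSn _)); lra.
  have [U FU xU] := Fl m x.
  have {}xU y : mdist x y < r -> U y by move=> xy; apply: xU; have := lr m (leqnn m); lra.
  have [inner|] := pselect (forall y, mdist x y < r -> mdist x0 y < ra m.+1).
    exists (col m U) => y xy; exists m; rewrite ym // inner //; split => //.
    by exists U => //; split => //; exact: xU.
  move=> /existsNP[z] /not_implyP[xz /negP]; rewrite -leNgt => zm.
  have [outr|] := pselect (forall y, mdist x y < r -> ra m.+1 <= mdist x0 y).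
    have [V FV xV] := Fl m.+1 x; exists (col m.+1 V) => y xy; exists m.+1.
    rewrite outr // ym2 //; split => //; exists V => //; split => //; apply: xV.
    by have := lr m.+1 (leqnSn m); lra.
  move=> /existsNP[w] /not_implyP[xw /negP]; rewrite -ltNge => wm.
  have [FV UV] := parP m U FU (ex_intro _ z (xU z xz)).
  have colU : col m U = c0 (par m U).
    by rewrite /col asboolT //; exists z => //; exact: xU.
  (* [par m U] contains [w], which comes before [ra m.+1], so it is too small to reach [ra m.+2] and
     keeps its own colour. *)
  have colV : col m.+1 (par m U) = c0 (par m U).
    rewrite /col asboolF // => -[y Vy ym3].
    have := Fd m.+1 _ FV w y (UV _ (xU w xw)) Vy.
    by have := metric_triangle x0 w y; have := ra_d m.+1; lra.
  exists (c0 (par m U)) => y xy.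
  have [yin|yout] := ltP (mdist x0 y) (ra m.+1).
    exists m; rewrite ym // yin; split => //.
    by exists U => //; split => //; exact: xU.
  exists m.+1; rewrite yout ym2 //; split => //.
  by exists (par m U) => //; split => //; exact/UV/xU.
- by move=> i x [k [/andP[kx _] [U FU [Ux <-]]]]; exact: colG.
- move=> x; apply: contrapT => /forallNP allH.
  have {}allH i : H i x by exact: contrapT (allH i).
  have [k [/andP[k1 k2] _]] := allH ord0.
  (* As [x] lies in a single zone, its [n.+2] colours come from distinct members of the same
     [F k]. *)
  have /choice[v vP] : forall i, exists U, [/\ F k U, U x & col k U = i].
    move=> i; have [k' [/andP[k1' k2'] [U FU [Ux Ui]]]] := allH i.
    suff kk : k = k' by exists U; rewrite kk.
    case: (ltngtP k k') => // /ra_le h.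
      by move: (le_lt_trans (le_trans h k1') k2); rewrite ltxx.
    by move: (le_lt_trans (le_trans h k1) k2'); rewrite ltxx.
  apply: (card_pigeonhole (v := v) (Fdim k x)).
    move=> i j vij; have [_ _ <-] := vP i; have [_ _ <-] := vP j.
    by rewrite vij.
  by move=> i; have [? ? _] := vP i.
Qed.

End asdim_shrinkable.

(** * Multiplicity of finite coarse covers *)

Section shrinking_finite_covers.
Context {R : realType} {X : metricType R} (x0 : X) (n : nat).
Hypothesis shr : shrinkable x0 n.

(** The sets are merged into [n.+2] classes along [p]; the merged cover is shrunk and intersected
    back with the supports of a partition of unity. *)
Lemma shrink_along (I : finType) (p : I -> 'I_n.+2) (G : I -> set X) :
  coarse_cover x0 G -> exists H : I -> set X, [/\ coarse_cover x0 H,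
    forall j, H j `<=` G j & forall x, exists i, forall j, p j = i -> ~ H j x].
Proof.
move=> /coarse_cover_partition[f [fslow f0 fG fsum]].
(* Where the [f j] sum to 1, some [f j x] exceeds [2 * c]. An oscillation below [c] leaves [f j > c]
   on the ball, and later turns [f j x > c] into [f j > 0]. *)
pose c : R := #|I|.+1%:R^-1 / 2.
have c0 : 0 < c by rewrite divr_gt0 // invr_gt0.
have f_close r : 0 < r -> \forall x \near far x0, forall j y,
    mdist x y < r -> `|f j x - f j y| < c.
  by move=> r0; apply: filter_forall => j; exact: fslow.
pose G' i := [set x | exists2 j, p j = i & c < f j x].
have [|W [Wcov WG' W0]] := shr (G := G').
  move=> r r0; apply: filterS (filterI fsum (f_close r r0)) => x [sum1 fx].
  have [j fj] : exists j, c + c < f j x.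
    apply: contrapT => /forallNP small; move: sum1; apply/eqP; rewrite lt_eqF //.
    apply: (@le_lt_trans _ _ (\sum_(j : I) (c + c))).
      by apply: ler_sum => j _; rewrite leNgt; apply/negP.
    rewrite sumr_const -mulr_natl -splitr ltr_pdivrMr // mul1r ltr_nat.
    by rewrite (eq_card (B := I)).
  exists (p j) => y xy; exists j => //.
  by have := fx j y xy; rewrite ltr_norml => /andP[_]; lra.
exists (fun j => [set x | 0 < f j x /\ W (p j) x]); split.
- move=> r r0; apply: filterS (filterI (Wcov r r0) (f_close r r0)).
  move=> x [[i xW] fx]; have [|j pj fj] := WG' i x.
    by apply: xW; rewrite mdistxx.
  exists j => y xy; split; last by rewrite pj; exact: xW.
  by have := fx j y xy; rewrite ltr_norml => /andP[_]; lra.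
- by move=> j x [/fG].
- by move=> x; have [i Wi] := W0 x; exists i => j pj [_]; rewrite pj.
Qed.

(** The cover is shrunk along every [p] in turn. If [n.+2] of the final sets met at a point, a [p]
    mapping them onto all classes would give a contradiction. *)
Lemma shrink_multiplicity (I : finType) (G : I -> set X) : coarse_cover x0 G ->
  exists H : I -> set X, [/\ coarse_cover x0 H, forall j, H j `<=` G j &
    forall x, [set j | H j x] #<= `I_n.+1].
Proof.
move=> Gcov.
have [H [Hcov HG Hs]] : exists H : I -> set X, [/\ coarse_cover x0 H,
    forall j, H j `<=` G j & forall p : {ffun I -> 'I_n.+2},
    p \in enum {: {ffun I -> 'I_n.+2}} ->
    forall x, exists i, forall j, p j = i -> ~ H j x].
  elim: (enum _) => [|p s [H [Hcov HG Hs]]]; first by exists G; split => // j x.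
  have [H' [H'cov H'H H'p]] := shrink_along p Hcov.
  exists H'; split => // [j x /H'H/HG //|q].
  rewrite inE => /orP[/eqP -> //|/Hs qs x].
  by have [i Hi] := qs x; exists i => j /Hi Hj /H'H.
exists H; split => // x; pose B := [set j | `[< H j x >]]%SET.
have HB j : H j x -> j \in B by move=> Hj; rewrite inE; exact/asboolP.
have [Bn|nB] := leqP #|B| n.+1.
  have [[j0 Hj0]|noH] := pselect (exists j, H j x); last first.
    rewrite (_ : [set j | H j x] = set0) ?card_ge0 //.
    by rewrite -subset0 => j Hj; case: noH; exists j.
  apply: card_le_trans (card_image_le (nth j0 (enum B)) `I_n.+1).
  apply: subset_card_le => j /HB jB; exists (index j (enum B)) => /=.
    by apply: leq_trans Bn; rewrite cardE index_mem mem_enum.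
  by rewrite nth_index // mem_enum.
pose v (i : 'I_n.+2) : I := enum_val (widen_ord nB i).
have vinj : injective v by move=> i j /enum_val_inj [] /val_inj.
pose p : {ffun I -> 'I_n.+2} := [ffun j => odflt ord0 [pick i | v i == j]].
have [|i /(_ (v i))] := Hs p _ x; first by rewrite mem_enum.
have pv : p (v i) = i.
  by rewrite ffunE; case: pickP => [k /eqP/vinj //|/(_ i)]; rewrite eqxx.
have : v i \in B by exact: enum_valP.
by rewrite inE => /asboolP Hv /(_ pv).
Qed.

End shrinking_finite_covers.

(** * Colouring and gluing bounded families *)

Section gluing_families.
Context {R : realType} {X : metricType R}.

(* Sorting the depths of [x] in the at most [N.+1] members containing it, there
   is a gap of length [4 * eta] below [4 * eta * N.+1]; points are coloured by
   the position of the gap, and labelled by the members above it. *)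
Lemma asdim_colouring N (eta : R) : asdim_le X N -> 0 < eta ->
  exists D (G : 'I_N.+1 -> set X) (lab : 'I_N.+1 -> X -> set (set X)),
  [/\ forall x, exists j, forall y, mdist x y < eta -> G j y,
      forall j x y, lab j x = lab j y -> mdist x y <= D &
      forall j x y, G j x -> G j y -> mdist x y < eta -> lab j x = lab j y].
Proof.
move=> /asdim_leP XN eta0; pose L : R := 4 * eta * N.+1%:R.
have [D [U [UD Udim UL]]] := XN L.
have L0 : 0 < L by rewrite !mulr_gt0.
pose u (V : set X) x := depth (fun=> L) V x.
have ulip V x y : u V x <= u V y + mdist x y.
  by apply: depth_lip => [?|? ?]; rewrite ?lerDl ?mdist_ge0 // ltW.
have u_in V x : 0 < u V x -> V x by apply: depth_gt0 => _; exact: ltW.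
have top x : exists2 V, U V & u V x = L.
  have [//|V UV xV] := UL x; exists V => //; apply/eqP; rewrite eq_le.
  by rewrite depth_le 1?depth_ball // => _; exact: ltW.
pose lo (j : nat) : R := 4 * eta * j%:R.
have loS j : lo j.+1 = lo j + 4 * eta by rewrite /lo -natr1; ring.
have lo_le i j : (i <= j)%N -> lo i <= lo j.
  by move=> ij; rewrite /lo ler_wpM2l ?ler_nat // mulr_ge0 // ltW.
have lo0 j : 0 <= lo j by rewrite !mulr_ge0 // ltW.
have LE : lo N.+1 = L by [].
pose lab (j : 'I_N.+1) x := [set V | U V /\ lo j.+1 - eta <= u V x].
(* The margins leave, at points of [G j], an interval of length [2 * eta] free of depths, which a
   displacement below [eta] cannot cross. *)
exists D, (fun j => [set x | forall V, U V ->
  ~ (lo j + eta < u V x < lo j.+1 - eta)]), lab; split.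
- move=> x; suff [j gap] : exists j : 'I_N.+1, forall V, U V ->
      ~ (lo j < u V x < lo j.+1).
    exists j => y xy V UV /andP[h1 h2]; apply: (gap V UV).
    have := ulip V x y; have := ulip V y x; rewrite (metric_sym y x).
    by move=> h3 h4; apply/andP; split; lra.
  apply: contrapT => /forallNP nogap.
  (* Without a gap, each of the [N.+1] levels below [L] is met by a member containing [x], and [L]
     by a member of full depth: one member too many. *)
  have /choice[v vP] : forall i : 'I_N.+2, exists V,
      [/\ U V, V x & lo i <= u V x < lo i.+1].
    move=> i; have [iN|Ni] := ltnP i N.+1.
      have := nogap (Ordinal iN) => /existsNP[V /not_implyP[UV /contrapT/=]].
      move=> /andP[h1 h2]; exists V; split => //; last by rewrite ltW.
      by apply: u_in; exact: le_lt_trans (lo0 i) h1.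
    have [V UV uV] := top x; exists V; split => //.
      by apply: u_in; rewrite uV.
    have -> : i = N.+1 :> nat by apply/eqP; rewrite eqn_leq Ni -ltnS ltn_ord.
    by rewrite uV (loS N.+1) LE lexx ltrDl mulr_gt0.
  apply: (card_pigeonhole (v := v) (Udim x)); last first.
    by move=> i; have [? ? _] := vP i.
  move=> i j vij; apply/val_inj; have [_ _ /andP[i1 i2]] := vP i.
  have [_ _] := vP j; rewrite -vij => /andP[j1 j2].
  case: (ltngtP i j) => // /lo_le h.
    by have := lt_le_trans i2 (le_trans h j1); rewrite ltxx.
  by have := lt_le_trans j2 (le_trans h i1); rewrite ltxx.
(* A member of full depth belongs to every label of [x], so points with equal labels share a member
   of [U]. *)
- move=> j x y xy; have [V UV uV] := top x.
  have jN := lo_le _ _ (ltn_ord j); have j0 := lo0 j; have jS := loS j.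
  have Vx : lab j x V by split => //; rewrite uV; lra.
  have Vy : lab j y V by rewrite -xy.
  by apply: (UD V UV); apply: u_in; [case: Vx|case: Vy] => _; lra.
- move=> j; suff sub x y : [set x | forall V, U V ->
      ~ (lo j + eta < u V x < lo j.+1 - eta)] y ->
      mdist x y < eta -> lab j x `<=` lab j y.
    move=> x y Gx Gy xy; apply/seteqP; split; apply: sub => //.
    by rewrite metric_sym.
  move=> Gy xy V [UV Vx]; split => //; rewrite leNgt; apply/negP => Vy.
  apply: (Gy V UV); rewrite Vy andbT.
  by have := ulip V x y; have := loS j; lra.
Qed.

(** Each family is cut down to the [l]-neighbourhood of its [S j]; these are disjoint, so a point
    sees one family only. *)
Lemma cover_at_separated n (l D : R) (S : nat -> set X) :
  (forall j, cover_at n l D (S j)) ->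
  (forall i j x y, S i x -> S j y -> mdist x y < l + l -> i = j) ->
  cover_at n l D (\bigcup_j S j).
Proof.
move=> /choice[U UP] Ssep.
pose nb j := [set y | exists2 s, S j s & mdist s y < l].
have nb_eq i j y : nb i y -> nb j y -> i = j.
  move=> [s Ss sy] [t St ty]; apply: (Ssep i j s t) => //.
  by have := metric_triangle s y t; rewrite (metric_sym y t); lra.
exists [set W | exists j V, U j V /\ W = V `&` nb j]; split.
- move=> _ [j [V [UV ->]]] x y [Vx _] [Vy _].
  by have [H _ _] := UP j; exact: H UV _ _ Vx Vy.
- move=> x; have [[j xj]|nox] := pselect (exists j, nb j x); last first.
    set T := (T in T #<= _); suff -> : T = set0 by exact: card_ge0.
    rewrite -subset0 => W [[j [V [UV ->]]] [Vx xj]]; apply: nox; exists j.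
    exact: xj.
  have [_ H _] := UP j; apply: card_le_trans (H x).
  apply: card_le_trans (card_image_le (fun V => V `&` nb j) _).
  apply: subset_card_le => _ [[i [V [UV ->]]] [Vx xi]].
  have ij := nb_eq _ _ _ xi xj; exists V; last by rewrite ij.
  by split => //; rewrite -ij.
- move=> x [j _ Sx]; have [_ _ H] := UP j; have [V UV xV] := H x Sx.
  exists (V `&` nb j); first by exists j, V.
  by move=> y xy; split; [exact: xV|exists x].
Qed.

(* Every member [V] of the coarser family absorbs, outside [S2], the members of
   the finer family which meet [S2] and are assigned to [V]. *)
Lemma cover_atU n (l D l' D' : R) (S1 S2 : set X) : 0 < l -> l <= l' ->
  D < l' -> (forall x, S1 x \/ S2 x) ->
  cover_at n (l + l) D S1 -> cover_at n l' D' S2 ->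
  cover_at n l (Num.max D D') [set: X].
Proof.
move=> l0 ll Dl S12 [U [UD Udim US]] [V [VD Vdim VS]].
pose meets (A : set X) := exists2 x, S2 x & A x.
have /choice[par parP] : forall A, exists B, U A -> meets A -> V B /\ A `<=` B.
  move=> A; have [[UA [x Sx Ax]]|] := pselect (U A /\ meets A); last first.
    by move=> H; exists set0 => ? ?; case: H.
  have [B VB xB] := VS x Sx; exists B => _ _; split => // y Ay; apply: xB.
  exact: le_lt_trans (UD A UA x y Ax Ay) Dl.
pose til B := [set x | (S2 x /\ B x) \/
  (~ S2 x /\ exists2 A, U A /\ par A = B & meets A /\ A x)].
have tilB B : til B `<=` B.
  move=> x [[]//|[_ [A [UA <-] [mA Ax]]]]; have [_ AB] := parP A UA mA.
  exact: AB.
exists [set W | (exists2 B, V B & W = til B) \/ (U W /\ ~ meets W)]; split.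
- move=> W [[B VB ->]|[UW _]] x y Wx Wy; rewrite le_max.
    by rewrite (VD B VB x y (tilB _ _ Wx) (tilB _ _ Wy)) orbT.
  by rewrite (UD W UW x y Wx Wy).
- move=> x; have [Sx|Sx] := pselect (S2 x).
    apply: card_le_trans (Vdim x).
    apply: card_le_trans (card_image_le til _); apply: subset_card_le.
    move=> W [[[B VB ->]|[_ mW]] Wx].
      by exists B => //; split => //; exact: tilB.
    by case: mW; exists x.
  apply: card_le_trans (Udim x).
  (* The image under [psi] of the members of [U] through [x] contains all glued members through
     [x]. *)
  pose psi A := if `[< meets A >] then til (par A) else A.
  apply: card_le_trans (card_image_le psi _); apply: subset_card_le.
  move=> W [[[B VB ->]|[UW mW]] Wx]; last by exists W => //; rewrite /psi asboolF.
  case: Wx => [[//]|[_ [A [UA AB] [mA Ax]]]].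
  by exists A => //; rewrite /psi asboolT // AB.
- move=> x _.
  (* A ball leaving [S2] does so at a point of [S1], whose ball of radius [l + l] contains it; hence
     the doubled scale on [S1]. *)
  have [[y xy Sy]|inS] := pselect (exists2 y, mdist x y < l & ~ S2 y); last first.
    have S2x y : mdist x y < l -> S2 y.
      by move=> xy; apply: contrapT => Sy; apply: inS; exists y.
    have [|B VB xB] := VS x; first by apply: S2x; rewrite mdistxx.
    exists (til B); first by left; exists B.
    move=> y xy; left; split; first exact: S2x.
    by apply: xB; exact: lt_le_trans xy ll.
  have S1y : S1 y by case: (S12 y).
  have [A UA yA] := US y S1y.
  have xA z : mdist x z < l -> A z.
    move=> xz; apply: yA; have := metric_triangle y x z.
    by rewrite (metric_sym y x); lra.
  have [mA|mA] := pselect (meets A); last by exists A => //; right.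
  have [VB AB] := parP A UA mA.
  exists (til (par A)); first by left; exists (par A).
  move=> z xz; have Az := xA z xz.
  have [Sz|Sz] := pselect (S2 z); first by left; split => //; exact: AB.
  by right; split => //; exists A.
Qed.

End gluing_families.

(** * From shrinkings to asymptotic dimension *)

Section shrinkable_asdim.
Context {R : realType} {X : metricType R} (x0 : X) (n N : nat).
Hypothesis shr : shrinkable x0 n.
Hypothesis XN : asdim_le X N.

(* If the covers failed to exist at a fixed scale [l] on annuli [N k, M k]
   escaping to infinity, then the colourings of dimension [N] and scale [k] on
   these annuli would form a coarse cover; its shrinking of dimension [n] would
   yield the missing covers. *)
Lemma cover_at_annuli (l : R) : 0 < l -> exists D r : R, forall s : R,
  cover_at n l D [set x | r <= mdist x0 x <= s].
Proof.
move=> l0; apply: contrapT => nocover.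
have /choice[S SP] : forall Dr : R * R, exists s : R,
    ~ cover_at n l Dr.1 [set x | Dr.2 <= mdist x0 x <= s].
  move=> [D r] /=; apply: contrapT => /forallNP Dr; apply: nocover.
  by exists D, r => s; exact: contrapT (Dr s).
have /choice[D /choice[G /choice[lab GP]]] : forall k : nat, exists D
    (G : 'I_N.+1 -> set X) (lab : 'I_N.+1 -> X -> set (set X)),
    [/\ forall x, exists j, forall y, mdist x y < k.+1%:R -> G j y,
      forall j x y, lab j x = lab j y -> mdist x y <= D &
      forall j x y, G j x -> G j y -> mdist x y < k.+1%:R ->
        lab j x = lab j y].
  by move=> k; apply: asdim_colouring XN _.
(* At the outer radius [S (D k', r k')] the cover fails; the extra terms keep the annuli, enlarged
   by [l], more than [k'.+1] apart. *)
pose r := fix r k : R := if k is k'.+1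
  then Num.max (r k') (S (D k', r k')) + l + l + k'.+1%:R else 0.
pose s k := S (D k, r k).
have rS k : r k.+1 = Num.max (r k) (s k) + l + l + k.+1%:R by [].
have r_r k : r k + k.+1%:R <= r k.+1.
  by have : r k <= Num.max (r k) (s k); [rewrite le_max lexx|rewrite rS; lra].
have r_s k : s k + l + l + k.+1%:R <= r k.+1.
  by have : s k <= Num.max (r k) (s k); [rewrite le_max lexx orbT|rewrite rS; lra].
have r_le : {homo r : i j / (i <= j)%N >-> i <= j}.
  by apply/nondecreasing_seqP => k; apply: le_trans (r_r k); rewrite lerDl.
have r_k k : k%:R <= r k.
  elim: k => [//|k IH]; apply: le_trans (r_r k).
  by have : 0 <= k%:R :> R by []; lra.
pose E k := [set x | r k - l < mdist x0 x < s k + l].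
have E_lt k k' y z : (k < k')%N -> E k y -> E k' z -> k.+1%:R < mdist y z.
  move=> /r_le rk /andP[_ yk] /andP[zk' _].
  by have := metric_triangle x0 y z; have := r_s k; lra.
pose G' j := [set x | forall k, E k x -> G k j x].
have G'cov : coarse_cover x0 G'.
  move=> t t0; pose K := Num.bound (t + t).
  have Kt : t + t < K%:R by exact: ltr_bound.
  exists (r K + t) => x xK.
  have EK y k : mdist x y < t -> E k y -> (K <= k)%N.
    move=> xy /andP[_ yk]; rewrite leqNgt; apply/negP => /r_le rk.
    have := metric_triangle x0 y x; rewrite (metric_sym y x).
    have := r_s k; have : 0 <= k.+1%:R :> R by [].
    by lra.
  have tk k : (K <= k)%N -> t + t < k.+1%:R.
    by move=> Kk; apply: lt_le_trans Kt _; rewrite ler_nat ltnW.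
  (* Far out, a ball meets at most one enlarged annulus, and only the colouring there restricts
     membership in [G']. *)
  have [[y [k [xy Ey]]]|noE] := pselect (exists y k, mdist x y < t /\ E k y); last first.
    by exists ord0 => y xy k Ey; case: noE; exists y, k.
  have [Gk _ _] := GP k; have [j yG] := Gk y; exists j => z xz k' Ez.
  have yz : mdist y z < t + t.
    by have := metric_triangle y x z; rewrite (metric_sym y x); lra.
  case: (ltngtP k k') => [kk|kk|<-].
  - by have := E_lt _ _ _ _ kk Ey Ez; have := tk _ (EK _ _ xy Ey); lra.
  - have := E_lt _ _ _ _ kk Ez Ey; rewrite (metric_sym z y).
    by have := tk _ (EK _ _ xz Ez); lra.
  - by apply: yG; exact: lt_trans yz (tk _ (EK _ _ xy Ey)).
have [H [Hcov HG' Hn]] := shrink_multiplicity shr G'cov.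
have [T HT] := Hcov l l0.
have [k Tk lk] : exists2 k : nat, T < k%:R & l < k%:R.
  exists (Num.bound (Num.max T l)); apply: le_lt_trans (ltr_bound _).
    by rewrite le_max lexx.
  by rewrite le_max lexx orbT.
apply: (SP (D k, r k)) => /=; have [_ labD labG] := GP k.
exists [set V | exists j L, V = [set y | [/\ H j y, E k y & lab k j y = L]]].
split.
- move=> _ [j [L ->]] x y [_ _ <-] [_ _ yL].
  exact: labD (esym yL).
(* Each [H j] through [x] contributes a single piece, the one with the label of [x]. *)
- move=> x; apply: card_le_trans (Hn x).
  pose V j := [set y | [/\ H j y, E k y & lab k j y = lab k j x]].
  apply: card_le_trans (card_image_le V _); apply: subset_card_le.
  by move=> _ [[j [L ->]] [Hj Ex <-]]; exists j.
- move=> x /andP[rx]; rewrite -/(s k) => xs.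
  have [|j xH] := HT x; first by apply: lt_le_trans rx; apply: lt_le_trans (r_k k).
  exists [set y | [/\ H j y, E k y & lab k j y = lab k j x]].
    by exists j, (lab k j x).
  have xE y : mdist x y < l -> E k y.
    have := metric_triangle x0 x y; have := metric_triangle x0 y x.
    by rewrite (metric_sym y x) => ? ? ?; apply/andP; split; lra.
  move=> y xy; have xx : mdist x x < l by rewrite mdistxx.
  split; [exact: xH|exact: xE|].
  apply: labG; [apply: HG'|apply: HG'|]; try exact: xH; try exact: xE.
  rewrite metric_sym; apply: lt_trans xy _; apply: lt_trans lk _.
  by rewrite ltr_nat.
Qed.

(** Annuli of a fixed width are sorted by parity. Those of equal parity are separated, so their
    union is covered uniformly; the two unions are glued, the scale on the even one exceeding the
    diameters on the odd one. *)
Lemma shrinkable_asdim : asdim_le X n.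
Proof.
apply/asdim_leP => l1; pose l : R := Num.max l1 0 + 1.
have l0 : 0 < l by rewrite ltr_wpDl // le_max lexx orbT.
have [D1 [r1 D1P]] := cover_at_annuli (addr_gt0 l0 l0).
pose l' : R := Num.max l (D1 + 1).
have ll' : l <= l' by rewrite le_max lexx.
have Dl' : D1 < l' by rewrite lt_max ltrDl ltr01 orbT.
have l'0 : 0 < l' by exact: lt_le_trans ll'.
have [D2 [r2 D2P]] := cover_at_annuli l'0.
pose r := Num.max (Num.max r1 r2) 0.
have [[rr1 rr2] r0] : (r1 <= r /\ r2 <= r) /\ 0 <= r.
  by rewrite !le_max !lexx !orbT.
(* The width exceeds [2 * l'] and [4 * l], the separations needed for even and odd annuli, and [r],
   which makes [h] nonnegative. *)
pose w := r + l' + l' + l + l + l + l + 1.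
have w1 : 1 <= w by rewrite /w; lra.
have w0 : 0 <= w by exact: le_trans w1.
(* The shift makes [Z 0] the open ball of radius [r] about [x0] and each later [Z m] an annulus
   outside it. *)
pose h x := mdist x0 x + w - r.
pose Z (m : nat) := [set x | m%:R * w <= h x < m.+1%:R * w].
have hlip x y : h y <= h x + mdist x y.
  by have := metric_triangle x0 x y; rewrite /h; lra.
have Zsep (t : R) b i j x y : t + t <= w -> Z (i.*2 + b)%N x -> Z (j.*2 + b)%N y ->
    mdist x y < t + t -> i = j.
  move=> tw; wlog ij : i j x y / (i <= j)%N.
    move=> wl Zx Zy xy; have [ij|/ltnW ji] := leqP i j; first exact: wl ij Zx Zy xy.
    by apply/esym; apply: wl ji Zy Zx _; rewrite metric_sym.
  move=> /andP[_ xi] /andP[yj _] xy; move: ij; rewrite leq_eqVlt => /orP[/eqP //|ij].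
  have : (i.*2 + b).+2%:R * w <= (j.*2 + b)%:R * w.
    by rewrite ler_wpM2r // ler_nat -!addSn leq_add2r -doubleS leq_double.
  rewrite -natr1 mulrDl mul1r => ijw; exfalso.
  by have := hlip x y; lra.
have Zannulus m x : (0 < m)%N -> Z m x -> r <= mdist x0 x <= m.+1%:R * w + r - w.
  move=> m0 /andP[mx xm].
  have wm : w <= m%:R * w by rewrite ler_peMl // ler1n.
  by move: mx xm; rewrite /h => mx xm; apply/andP; split; lra.
have Zcov x : exists m, Z m x.
  have [| |m] := @zone_exists R (fun m => m%:R * w) (h x).
  - by move=> m; rewrite ler_peMr.
  - by rewrite mul0r /h; have := mdist_ge0 x0 x; rewrite /w; lra.
  - by move=> Zm; exists m.
pose S1 := \bigcup_j Z (j.*2 + 1)%N; pose S2 := \bigcup_j Z (j.*2 + 0)%N.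
pose D3 := Num.max D2 ((r + l') + (r + l')).
have cov1 : cover_at n (l + l) D1 S1.
  apply: cover_at_separated => [j|i j x y].
    apply: cover_atS (D1P ((j.*2 + 1).+1%:R * w + r - w)) => // x Zx.
    have j0 : (0 < j.*2 + 1)%N by rewrite addn1.
    have /andP[rx xs] := Zannulus _ _ j0 Zx.
    by apply/andP; split => //; exact: le_trans rx.
  by apply: Zsep; rewrite /w; lra.
have cov2 : cover_at n l' D3 S2.
  apply: cover_at_separated => [j|i j x y]; last by apply: Zsep; rewrite /w; lra.
  (* The central [Z 0] is out of reach of [D2P]; a single ball covers it. *)
  case: j => [|j].
    exists [set [set y | mdist x0 y < r + l']]; split.
    - move=> _ -> x y /= xr yr; rewrite le_max; apply/orP; right.
      by have := metric_triangle x x0 y; rewrite (metric_sym x x0); lra.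
    - move=> x; apply: (@card_le_trans _ _ _ `I_1); last first.
        by rewrite card_le_II.
      apply: card_le_trans (card_image_le
        (fun=> [set y | mdist x0 y < r + l']) `I_1).
      by apply: subset_card_le => _ [-> _]; exists 0%N.
    - move=> x /andP[_ x1]; exists [set y | mdist x0 y < r + l'] => // y xy /=.
      have := metric_triangle x0 x y; move: x1.
      by rewrite mul1r /h; lra.
  apply: cover_atS (D2P ((j.+1.*2 + 0).+1%:R * w + r - w)) => //.
    by rewrite le_max lexx.
  move=> x Zx; have /andP[rx xs] := @Zannulus (j.+1.*2 + 0)%N x isT Zx.
  by apply/andP; split => //; exact: le_trans rx.
have S12 x : S1 x \/ S2 x.
  have [m Zm] := Zcov x; have mE := odd_double_half m.
  case: (odd m) mE => mE; [left|right]; exists m./2 => //.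
    by rewrite addnC mE.
  by rewrite addn0 -[m./2.*2]add0n mE.
exists (Num.max D1 D3).
apply: cover_atS (cover_atU l0 ll' Dl' S12 cov1 cov2) => //.
by rewrite /l; have : l1 <= Num.max l1 0; [rewrite le_max lexx|lra].
Qed.

End shrinkable_asdim.

Theorem proposition6p2 (R : realType) (X : metricType R) (n : nat) :
  finite_asdim X ->
  (large_scale_absolute_extensor (sphere R n) X <-> asdim_le X n).
Proof.
(* Without a base point [X] is empty and both conditions hold trivially. *)
move=> [N XN]; have [[x0]|noX] := pselect (inhabited X); last first.
  split=> _.
    apply/asdim_leP => l; exists 0, set0; split => [//|x|x].
      by case: noX.
    by case: noX.
  move=> A f _; exists (fun=> Sphere (vertex_boundary (n := n))).
    by move=> x; case: noX.
  by move=> a; case: noX; constructor; exact: set_val a.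
split=> [/extensor_shrinkable|/asdim_shrinkable] Xn.
  exact: shrinkable_asdim (Xn x0) XN.
exact: shrinkable_extensor (Xn x0).
Qed.
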